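(* Let $(X,d)$ be a metric space and $Y\subseteq X$ be a closed subset. If $Y$ is locally compact or $Y$ is complete in the metric induced by $d$, then the restriction map $$C(X,F)\to C(Y,F),\quad\gamma\mapsto\gamma|_Y,$$ admits a continuous linear right inverse, for each locally convex space $F$.
   Context: ''Locally convex space'' means a real, Hausdorff locally convex topological vector space (not assumed complete). For a topological space $X$, $C(X,F)$ is the space of all continuous maps $X\to F$ (not necessarily bounded), endowed with the compact-open topology. *)

(* Defs.v *)
From HB Require Import structures.
From mathcomp Require Import all_boot all_order all_algebra.
From mathcomp Require Import all_classical all_reals all_analysis.

Set Implicit Arguments.
Unset Strict Implicit.
Unset Printing Implicit Defensive.

Import Order.TTheory GRing.Theory Num.Theory.
Import numFieldNormedType.Exports.

Local Open Scope classical_set_scope.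
Local Open Scope ring_scope.

(* Topologizes [continuousType X F] by the compact-open topology; the library
   offers competing topologies on this type in sibling modules. *)
Export ArrowAsCompactOpen.

Section continuous_lmodule.
Context {R : numDomainType} {X : topologicalType} {F : topologicalLmodType R}.
Implicit Types (f g : continuousType X F) (c : R).

Let cts_zero : continuous (fun _ : X => 0 : F).
Proof. by move=> x; exact: cvg_cst. Qed.

Let cts_opp f : continuous (fun x => - f x).
Proof.
by move=> x; apply: (continuous_comp (@cts_fun _ _ f x)); exact: opp_continuous.
Qed.

Let cts_add f g : continuous (fun x => f x + g x).
Proof.
move=> x; apply: (@continuous_comp _ _ _ (fun x => (f x, g x))
  (fun z : F * F => z.1 + z.2)); last exact: add_continuous.
by apply: cvg_pair; exact: cts_fun.
Qed.

Let cts_scale c f : continuous (fun x => c *: f x).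
Proof.
move=> x; apply: (@continuous_comp _ _ _ (fun x => (c : R^o, f x))
  (fun z : R^o * F => z.1 *: z.2)); last exact: scale_continuous.
by apply: (@cvg_pair _ _ _ _ (nbhs (c : R^o)));
  [exact: cvg_cst | exact: cts_fun].
Qed.

Let zero : continuousType X F := mkcts cts_zero.
Let opp f : continuousType X F := mkcts (@cts_opp f).
Let add f g : continuousType X F := mkcts (@cts_add f g).
Let scale c f : continuousType X F := mkcts (@cts_scale c f).

Let addA : associative add.
Proof. by move=> f g h; apply/continuousEP => x; exact: addrA. Qed.

Let addC : commutative add.
Proof. by move=> f g; apply/continuousEP => x; exact: addrC. Qed.

Let add0 : left_id zero add.
Proof. by move=> f; apply/continuousEP => x; exact: add0r. Qed.

Let addN : left_inverse zero opp add.
Proof. by move=> f; apply/continuousEP => x; exact: addNr. Qed.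

HB.instance Definition _ :=
  GRing.isZmodule.Build (continuousType X F) addA addC add0 addN.

Let scaleA c d f : scale c (scale d f) = scale (c * d) f.
Proof. by apply/continuousEP => x; exact: scalerA. Qed.

Let scale1 : left_id 1 scale.
Proof. by move=> f; apply/continuousEP => x; exact: scale1r. Qed.

Let scaleDr : right_distributive scale +%R.
Proof. by move=> c f g; apply/continuousEP => x; exact: scalerDr. Qed.

Let scaleDl f : {morph scale^~ f : c d / c + d}.
Proof. by move=> c d; apply/continuousEP => x; exact: scalerDl. Qed.

HB.instance Definition _ := GRing.Zmodule_isLmodule.Build R (continuousType X F)
  scaleA scale1 scaleDr scaleDl.

Lemma ctsDE f g x : (f + g) x = f x + g x. Proof. by []. Qed.

Lemma ctsZE c f x : (c *: f) x = c *: f x. Proof. by []. Qed.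

End continuous_lmodule.

Section restriction.
Context {X F : topologicalType} (Y : set X) (f : continuousType X F).

Lemma sigL_cts : continuous (sigL Y f).
Proof.
move=> y; apply: continuous_comp; last exact: cts_fun.
exact: (@initial_continuous Y X set_val).
Qed.

Definition cts_restr : continuousType Y F := mkcts sigL_cts.

End restriction.

Section induced_metric.
Context {R : realType} {X : metricType R} (Y : set X).

Let dist (x y : Y) : R := mdist (set_val x) (set_val y).

Let dist_ge0 x y : 0 <= dist x y. Proof. exact: mdist_ge0. Qed.

Let dist_positivity x y : dist x y = 0 -> x = y.
Proof. by move/mdist_positivity/val_inj. Qed.

Let ballEdist (x : Y) d : ball x d = [set y | dist x y < d].
Proof. by rewrite -initial_ballE ballEmdist. Qed.

HB.instance Definition _ := PseudoMetric_isMetric.Build R (set_type Y)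
  dist_ge0 dist_positivity ballEdist.

Lemma mdist_setE (x y : Y) : mdist x y = mdist (set_val x) (set_val y).
Proof. by []. Qed.

End induced_metric.

(* The library's [completeType] and [cvg] are restricted to pointed, hence
   nonempty, types. *)
Definition complete_metric {R : realType} (M : metricType R) : Prop :=
  forall u : nat -> M, cauchy (u @ \oo) -> exists l : M, u @ \oo --> l.

(* Main.v *)
(* Dugundji's extension. Off Y, the extension of f at x is a finite convex
   combination of values f c with mdist x c <= 2 mdist x z for all z in Y, the
   weights being a locally finite partition of unity independent of f. For
   compact K, the points c occurring over points of K form, together with K
   inside Y, a compact subset of Y: near a point of Y they converge to it, and
   near a point off Y only finitely many of them occur. So the extension of f on
   K is controlled by f on a compact set, with no assumption on Y beyond
   closedness and no completeness of F. The partition of unity comes from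
   M. E. Rudin's proof of Stone's theorem. *)
From HB Require Import structures.
Require Import Defs.
From mathcomp Require Import all_boot all_order all_algebra.
From mathcomp Require Import all_classical all_reals all_analysis.
From mathcomp Require Import wochoice ring lra.

Set Implicit Arguments.
Unset Strict Implicit.
Unset Printing Implicit Defensive.

Import Order.TTheory GRing.Theory Num.Theory.
Import numFieldNormedType.Exports.

Local Open Scope classical_set_scope.
Local Open Scope ring_scope.

(** * Metric and order preliminaries: plateau functions and strict well-orders *)

Section distance_to_a_set.
Context {R : realType} {X : metricType R}.
Implicit Types (A : set X) (x y z : X).

Definition mdist_inf A x : R := inf [set mdist x z | z in A].

Let mdist_has_lbound A x : has_lbound [set mdist x z | z in A].
Proof. by exists 0 => _ [z _ <-]; exact: mdist_ge0. Qed.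

Lemma mdist_inf_le A x z : A z -> mdist_inf A x <= mdist x z.
Proof. by move=> Az; apply: ge_inf => //; exists z. Qed.

Lemma mdist_inf_lt A x (r : R) : A !=set0 -> mdist_inf A x < r ->
  exists2 z, A z & mdist x z < r.
Proof.
move=> A0 xr; have [|_ [z Az <-] zr] := inf_lt _ xr; last by exists z.
exact: image_nonempty.
Qed.

Lemma mdist_inf_lip A x y : mdist_inf A x <= mdist x y + mdist_inf A y.
Proof.
have [->|/set0P A0] := eqVneq A set0.
  by rewrite /mdist_inf !image_set0 inf0 addr0 mdist_ge0.
rewrite -lerBlDl; apply: lb_le_inf; first exact: image_nonempty.
move=> _ [z Az <-]; rewrite lerBlDl.
by rewrite (le_trans (mdist_inf_le x Az))// metric_triangle.
Qed.

Lemma mdist_lip_continuous (f : X -> R) :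
  (forall x y, f x <= mdist x y + f y) -> continuous f.
Proof.
move=> flip x; apply/cvgrPdist_lt => e e0; near=> y.
have xy : mdist x y < e.
  near: y; have := nbhsx_ballx x e e0.
  by rewrite ballEmdist.
rewrite ltr_norml; have := flip x y; have := flip y x.
rewrite (metric_sym y x); lra.
Unshelve. all: by end_near. Qed.

Lemma mdist_inf_continuous A : continuous (mdist_inf A).
Proof. exact/mdist_lip_continuous/mdist_inf_lip. Qed.

Lemma mdist_inf_gt0 A x : closed A -> A !=set0 -> ~ A x -> 0 < mdist_inf A x.
Proof.
move=> cA A0 nAx; have := closed_openC cA; rewrite openE => /(_ x nAx).
rewrite /interior -nbhs_ballE => -[e /= e0 eA].
rewrite ltNge; apply/negP => d0.
have [z Az xz] := mdist_inf_lt A0 (le_lt_trans d0 e0).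
by apply: (eA z) Az; rewrite ballEmdist.
Qed.

Lemma plateau A (r : R) : 0 < r ->
  exists v : X -> R, [/\ continuous v, forall x, 0 <= v x <= 1,
    forall x z, A z -> mdist x z <= r -> v x = 1 &
    forall x, v x != 0 -> exists2 z, A z & mdist x z < 2 * r].
Proof.
move=> r0; have [->|/set0P A0] := eqVneq A set0.
  (* The infimum over the empty set is 0, so the formula used below would give the constant 1 here,
     violating the support condition. *)
  exists (fun=> 0); split => //; first by move=> x; exact: cvg_cst.
    by move=> x; rewrite lexx ler01.
  by move=> x; rewrite eqxx.
exists (fun x => Num.min 1 (Num.max 0 (2 - r^-1 * mdist_inf A x))); split.
- move=> x; apply: (@continuous_min _ _ (fun=> 1)
    (fun x => Num.max 0 (2 - r^-1 * mdist_inf A x))); first exact: cvg_cst.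
  apply: (@continuous_max _ _ (fun=> 0) (fun x => 2 - r^-1 * mdist_inf A x)).
    exact: cvg_cst.
  apply: continuousB; first exact: cvg_cst.
  by apply: continuousM; [exact: cvg_cst|exact: mdist_inf_continuous].
- by move=> x; rewrite ge_min lexx le_min ler01 le_max lexx.
- move=> x z Az xz; apply/min_idPl; rewrite le_max; apply/orP; right.
  suff : r^-1 * mdist_inf A x <= 1 by lra.
  by rewrite ler_pdivrMl// mulr1 (le_trans (mdist_inf_le x Az)).
- move=> x v0; apply: mdist_inf_lt => //; rewrite ltNge; apply/negP => rx.
  move/eqP: v0; apply; rewrite (_ : Num.max _ _ = 0) ?min_r ?ler01//.
  by apply/max_idPl; rewrite subr_le0 ler_pdivlMl// mulrC.
Qed.

End distance_to_a_set.

(** Minima of two-element sets make the well-order [W] total, and their uniqueness makes it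
    antisymmetric; [S] is its irreflexive part. *)
Lemma strict_well_order (T : eqType) : exists S : rel T,
  (forall b c, b != c -> S b c \/ S c b) /\
  (forall A : set T, A !=set0 -> exists2 c, A c & forall b, S b c -> ~ A b).
Proof.
have [W wo] := well_ordering_principle T.
have totW b c : W b c || W c b.
  have [|z [[+ zmin] _]] := wo (mem [:: b; c]).
    by exists b; rewrite inE eqxx.
  rewrite !inE => /orP[]/eqP <-.
    by rewrite zmin// !inE eqxx orbT.
  by rewrite orbC zmin// !inE eqxx.
have antiW b c : W b c -> W c b -> b = c.
  move=> bc cb.
  have [|z [_ zuniq]] := wo (mem [:: b; c]).
    by exists b; rewrite inE eqxx.
  have Wxx x : W x x by have := totW x x; rewrite orbb.
  rewrite -(zuniq b) ?(zuniq c)//; split; rewrite ?inE ?eqxx ?orbT//.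
    by move=> x; rewrite !inE => /orP[]/eqP ->.
  by move=> x; rewrite !inE => /orP[]/eqP ->.
exists (fun b c => (b != c) && W b c); split => [b c bc|A [a0 Aa0]].
  by rewrite /= (eq_sym c) bc; apply/orP; exact: totW.
have [|c [[Ac cmin] _]] := wo [pred b | `[< A b >]].
  by exists a0; apply: asboolT.
exists c; first exact: asboolW Ac.
move=> b /andP[/eqP bc Wbc] Ab; apply/bc/antiW => //.
by apply: cmin; apply: asboolT.
Qed.

(** * Rudin's construction: locally constant choice of nearly closest points of [Y] *)

Section dugundji.
Context {R : realType} {X : metricType R} (Y : set X).
Hypotheses (closedY : closed Y) (Y0 : Y !=set0).

Lemma dugundji_selection :
  exists (v : nat -> X -> R) (a : nat -> X -> Y),
  [/\ forall n, continuous (v n), forall n x, 0 <= v n x <= 1,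
    forall x : X, ~ Y x -> exists n, \forall y \near x, v n y = 1,
    forall n (x : X), exists c, \forall y \near x, v n y != 0 -> a n y = c &
    forall n x (z : Y), v n x != 0 ->
      mdist x (set_val (a n x)) <= 2 * mdist x (set_val z)].
Proof.
have [S [Stot Swf]] := strict_well_order Y.
(* Positivity of [g c x] says that [c] is within twice the distance from [x] to [Y]. The Lipschitz
   constant 3 is 2 for the distance to [Y] plus 1 for the distance to [c]. *)
pose g (c : Y) x := 2 * mdist_inf Y x - mdist x (set_val c).
have glip c x y : g c x <= 3 * mdist x y + g c y.
  rewrite /g; have := mdist_inf_lip Y x y.
  have := metric_triangle y x (set_val c); rewrite (metric_sym y x); lra.
pose e n : R := n.+1%:R^-1.
have e0 n : 0 < e n by rewrite invr_gt0.
(* 24 makes 6 r n smaller than e n / 3, the separation of the sets [D n c], and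
   keeps g c positive within distance 2 r n of [D n c]. *)
pose r n := e n / 24.
have r0 n : 0 < r n by rewrite divr_gt0.
(* The gap between the two thresholds makes the family [D n c], for fixed n,
   uniformly discrete, since the functions g c are 3-Lipschitz. *)
pose D n (c : Y) :=
  [set x | 2 * e n < g c x /\ forall b, S b c -> g b x <= e n].
have Dsep n c c' z z' : D n c z -> D n c' z' -> 3 * mdist z z' < e n -> c = c'.
  move=> [cz cz'] [c'z c'z'] zz'; apply/eqP/negP => /negP /Stot[] Scc'.
    by have := c'z' _ Scc'; have := glip c z z'; lra.
  by have := cz' _ Scc'; have := glip c' z' z; rewrite (metric_sym z' z); lra.
have /choice[v vP] n := plateau (\bigcup_c D n c) (r0 n).
have [y0 Yy0] := Y0; pose y0Y : Y := SigSub (mem_set Yy0).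
(* Where [v n] vanishes, [a] takes the dummy value [y0Y]. *)
have /choice[a aP] : forall nx : nat * X, exists c : Y, v nx.1 nx.2 != 0 ->
    exists2 z, D nx.1 c z & mdist nx.2 z < 2 * r nx.1.
  move=> [n x] /=; have [v0|v0] := eqVneq (v n x) 0.
    by exists y0Y.
  have [_ _ _ /(_ x v0)[z [c _ Dz] xz]] := vP n.
  by exists c => _; exists z.
exists v, (fun n x => a (n, x)); split.
- by move=> n; have [] := vP n.
- by move=> n; have [] := vP n.
- move=> x nYx.
  (* The distance from [x] to [Y] is positive, so some point of [Y] is closer than twice that
     distance. The [S]-least such [c] puts [x] into [D n c] for large [n], as every earlier [b] has
     [g b x <= 0]. *)
  have [c gc cmin] : exists2 c, 0 < g c x & forall b, S b c -> ~ (0 < g b x).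
    apply: (Swf [set c | 0 < g c x]).
    have d0 := mdist_inf_gt0 closedY Y0 nYx.
    have [|z Yz xz] := @mdist_inf_lt _ _ _ x (2 * mdist_inf Y x) Y0; first lra.
    by exists (SigSub (mem_set Yz)); rewrite /= subr_gt0.
  have [n en] : exists n, 2 * e n < g c x.
    have g20 : 0 < g c x / 2 by rewrite divr_gt0.
    have [n _ nP] := near_infty_natSinv_lt (PosNum g20).
    exists n; rewrite mulrC -ltr_pdivlMr//; exact: nP n (leqnn n).
  have Dx : D n c x.
    by split => // b /cmin/negP; rewrite -leNgt => /le_trans -> //; exact: ltW.
  exists n; near=> y; have [_ _ v1 _] := vP n.
  apply: (v1 y x); first by exists c.
  rewrite ltW// metric_sym; near: y; have := nbhsx_ballx x _ (r0 n).
  by rewrite ballEmdist.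
- move=> n x.
  (* If some [y1] near [x] has [v n y1 != 0], its chosen point serves all such [y]: the path [z],
     [y], [x], [y1], [z1] is shorter than 2 + 1 + 1 + 2 = 6 times [r n], so [Dsep] applies.
     Otherwise any point will do. *)
  have [[y1 xy1 vy1]|] := pselect (exists2 y, mdist x y < r n & v n y != 0).
    exists (a (n, y1)); near=> y => vy.
    have xy : mdist x y < r n.
      near: y; have := nbhsx_ballx x _ (r0 n).
      by rewrite ballEmdist.
    have [z1 Dz1 /= yz1] := aP (n, y1) vy1; have [z Dz /= yz] := aP (n, y) vy.
    apply: (Dsep _ _ _ _ _ Dz Dz1).
    have := metric_triangle z y z1; have := metric_triangle y x z1.
    have := metric_triangle x y1 z1; rewrite (metric_sym z y) (metric_sym y x).
    have : r n * 24 = e n by rewrite /r divfK.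
    have := r0 n; lra.
  move=> novy; exists y0Y; near=> y => vy; exfalso; apply: novy; exists y => //.
  near: y; have := nbhsx_ballx x _ (r0 n).
  by rewrite ballEmdist.
- move=> n x z vx; have [w [gw _] /= xw] := aP (n, x) vx.
  have := glip (a (n, x)) w x; rewrite (metric_sym w x) /g in gw *.
  have := mdist_inf_le x (set_valP z).
  have : r n * 24 = e n by rewrite /r divfK.
  have := r0 n; have := e0 n; lra.
Unshelve. all: by end_near. Qed.

End dugundji.

(** * Stick-breaking weights *)

Section stick_breaking.
Context {R : numDomainType} (v : nat -> R).

(** The product is what is left of a unit stick after [n] breaks, and [v n] is the fraction of it
    broken off next. Each piece is the difference of two consecutive remainders, so the sums
    telescope. *)
Definition stick n : R := v n * \prod_(i < n) (1 - v i).

Lemma sum_stick N : \sum_(n < N) stick n = 1 - \prod_(i < N) (1 - v i).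
Proof.
elim: N => [|N IH]; first by rewrite !big_ord0 subrr.
rewrite !big_ord_recr /= IH /stick; ring.
Qed.

Lemma stick_ge0 n : (forall i, 0 <= v i <= 1) -> 0 <= stick n.
Proof.
move=> v01; have [v0 _] := andP (v01 n); rewrite mulr_ge0// prodr_ge0// => i _.
by rewrite subr_ge0; case/andP: (v01 i).
Qed.

Lemma stick_prod0 n N : (n < N)%N -> v n = 1 -> \prod_(i < N) (1 - v i) = 0.
Proof. by move=> nN v1; rewrite (bigD1 (Ordinal nN))//= v1 subrr mul0r. Qed.

End stick_breaking.

(** * The locally finite partition of unity off [Y] *)

Section dugundji_partition.
Context {R : realType} {X : metricType R} (Y : set X).
Hypotheses (closedY : closed Y) (Y0 : Y !=set0).

Lemma dugundji_partition :
  exists (p : nat -> X -> R) (a : nat -> X -> Y) (N : X -> nat),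
  [/\ forall n, continuous (p n), forall n x, 0 <= p n x,
    forall x : X, ~ Y x -> \forall y \near x, \sum_(n < N x) p n y = 1 /\
      forall n, (N x <= n)%N -> p n y = 0,
    forall n (x : X), exists c, \forall y \near x, p n y != 0 -> a n y = c &
    forall n x (z : Y), p n x != 0 ->
      mdist x (set_val (a n x)) <= 2 * mdist x (set_val z)].
Proof.
have [v [a [vcts v01 v1 a_loc a_near]]] := dugundji_selection closedY Y0.
(* Once v n = 1 near x, all later weights vanish near x: hence local finiteness
   and total mass 1. *)
pose p n x := stick (v ^~ x) n.
have pv n x : p n x != 0 -> v n x != 0.
  by apply: contra => /eqP vn0; rewrite /p /stick vn0 mul0r.
have /choice[N NP] : forall x : X, exists N, ~ Y x ->
    \forall y \near x, \sum_(n < N) p n y = 1 /\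
      forall n, (N <= n)%N -> p n y = 0.
  move=> x; have [Yx|/v1[n vn1]] := pselect (Y x); first by exists 0%N.
  (* The cutoff is [n.+1] because the piece of index [n] is the one that takes the whole
     remainder. *)
  exists n.+1 => _; near=> y; have vny : v n y = 1 by near: y.
  split; first by rewrite sum_stick (@stick_prod0 _ (v ^~ y) n)// subr0.
  by move=> m nm; rewrite /p /stick (@stick_prod0 _ (v ^~ y) n)// mulr0.
exists p, a, N; split => //.
- move=> n x.
  apply: (@continuousM _ _ (v n) (fun x => \prod_(i < n) (1 - v i x))).
    exact: vcts.
  apply: continuous_big => [|i _ {}x]; first exact: mul_continuous.
  by apply: continuousB; [exact: cvg_cst|exact: vcts].
- by move=> n x; exact: stick_ge0.
- move=> n x; have [c ac] := a_loc n x; exists c.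
  by apply: filterS ac => y ay /pv/ay.
- by move=> n x z /pv; exact: a_near.
Unshelve. all: by end_near. Qed.

End dugundji_partition.

(** * Convex combinations and neighbourhoods in the compact-open topology *)

Lemma convex_set_sum (R : realFieldType) (F : lmodType R) (V : set F) N
    (c : nat -> R) (z : nat -> F) : convex_set V ->
  (forall n, 0 <= c n) -> \sum_(n < N) c n = 1 ->
  (forall n, c n != 0 -> V (z n)) -> V (\sum_(n < N) c n *: z n).
Proof.
move=> convV c0 c1 zV.
have sum0 M : 0 <= \sum_(n < M) c n by apply: sumr_ge0.
(* [convex_set] concerns two points at a time, so the induction normalises each partial sum of
   positive mass to a point of [V]. *)
suff H M : 0 < \sum_(n < M) c n ->
    exists2 w, V w & \sum_(n < M) c n *: z n = (\sum_(n < M) c n) *: w.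
  have [|w Vw ->] := H N; first by rewrite c1.
  by rewrite c1 scale1r.
elim: M => [|M IH]; first by rewrite big_ord0 ltxx.
rewrite !big_ord_recr /=; set s := \sum_(n < M) c n in IH *.
(* With no mass so far, all earlier weights vanish and [z M] itself is the normalised point. *)
have [s0 t0|s0] := eqVneq s 0.
  have cM n : (n < M)%N -> c n = 0.
    move=> nM; apply/eqP; rewrite eq_le c0 andbT -s0 /s.
    by rewrite (bigD1 (Ordinal nM))//= lerDl sumr_ge0.
  have -> : \sum_(n < M) c n *: z n = 0.
    by rewrite big1// => i _; rewrite cM// scale0r.
  move: t0; rewrite s0 !add0r; have [cM0|cM0] := eqVneq (c M) 0.
    by rewrite cM0 ltxx.
  by exists (z M) => //; exact: zV.
have {}s0 : 0 < s by rewrite lt_neqAle eq_sym s0 sum0.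
have [w Vw ->] := IH s0 => t0.
have [cM0|cM0] := eqVneq (c M) 0.
  by exists w => //; rewrite cM0 addr0 scale0r addr0.
have l01 : 0 <= s / (s + c M) <= 1.
  by rewrite divr_ge0 ?(ltW s0) ?(ltW t0)//= ler_pdivrMr// mul1r lerDl.
pose l : {i01 R} := Itv01 (proj1 (andP l01)) (proj2 (andP l01)).
have /set_mem Vl := convV w (z M) l (mem_set Vw) (mem_set (zV _ cM0)).
exists (conv l (w : convex_lmodType F) (z M)) => //.
rewrite /conv /= scalerDr !scalerA /unstable.onem; congr (_ *: _ + _ *: _).
  by field; rewrite gt_eqF.
by field; rewrite gt_eqF.
Qed.

Lemma tvs_convex_nbhs (R : numDomainType) (F : tvsType R) (z : F) (V : set F) :
  nbhs z V -> exists W : set F, [/\ convex_set W, nbhs z W & W `<=` V].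
Proof.
have [B convB [openB basisB]] := @locally_convex R F.
move=> /basisB[W [BW Wz] WV]; exists W; split => //.
  by apply: convB; rewrite inE.
by apply: open_nbhs_nbhs; split => //; exact: openB.
Qed.

(** Uniform closeness on a compact set is obtained locally: near each [c] in [L], one compact-open
    condition keeps [g] and [f] in a common small open set, and compactness of [L] combines these
    conditions. *)
Lemma compact_open_near_sub (R : numDomainType) (T : uniformType)
    (F : topologicalLmodType R) (f : continuousType T F) (L : set T)
    (V : set F) : compact L -> nbhs 0 V ->
  nbhs f [set g : continuousType T F | forall c, L c -> V (g c - f c)].
Proof.
move=> cptL V0; have /compact_near_coveringP/near_covering_withinP covL := cptL.
apply: (covL _ (nbhs f) (fun (g : continuousType T F) c => V (g c - f c))).
move=> c Lc.
have := @sub_continuous F (f c, f c) V; rewrite /= subrr => /(_ V0).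
move=> [[A1 A2] /= [fA1 fA2] AV].
pose O := (A1 `&` A2)^°.
have oO : open O by exact: open_interior.
have fO : nbhs (f c) O by apply/nbhs_interior/filterI.
(* Regularity of [T] makes [f] map even the closure of [C] into [O], so the compact set [L] meets
   that closure in a compact set, as a subbasic condition requires. *)
have [C Cc CO] := uniform_regular (@cts_fun _ _ f c _ fO).
have cptLC : compact (L `&` closure C).
  by apply: compact_closedI => //; exact: closed_closure.
exists (C, [set g : continuousType T F | g @` (L `&` closure C) `<=` O]).
  split => //=.
  have := @initial_continuous (continuousType T F) (T -> F) id f
    [set g : T -> F | g @` (L `&` closure C) `<=` O]; apply.
  apply: open_nbhs_nbhs; split; first exact: compact_open_open.
  by move=> _ [d [_ /CO fd] <-].
move=> [d g] /= [Cd gO] Ld.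
have [_ A2fd] := interior_subset (CO _ (subset_closure Cd)).
have /gO/interior_subset[A1gd _] : [set g x | x in L `&` closure C] (g d).
  by exists d => //; split => //; exact: subset_closure.
exact: (AV (g d, f d)).
Qed.

(** * The extension operator and its continuity *)

Section extension.
Context {R : realType} {X : metricType R} (Y : set X) (closedY : closed Y).
Context (p : nat -> X -> R) (a : nat -> X -> Y) (N : X -> nat).
Hypothesis p_cts : forall n, continuous (p n).
Hypothesis p_ge0 : forall n x, 0 <= p n x.
Hypothesis p_part : forall x : X, ~ Y x ->
  \forall y \near x, \sum_(n < N x) p n y = 1 /\
    forall n, (N x <= n)%N -> p n y = 0.
Hypothesis a_loc : forall n (x : X),
  exists c, \forall y \near x, p n y != 0 -> a n y = c.
Hypothesis a_near : forall n x (z : Y), p n x != 0 ->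
  mdist x (set_val (a n x)) <= 2 * mdist x (set_val z).

Definition ext {F : lmodType R} (f : Y -> F) (x : X) : F :=
  if insub x is Some y then f y else \sum_(n < N x) p n x *: f (a n x).

(* The points of Y whose values under f determine [ext f x]. *)
Definition supp (x : X) (c : Y) : Prop :=
  set_val c = x \/ ~ Y x /\ exists2 n, p n x != 0 & a n x = c.

Lemma ext_val (F : lmodType R) (f : Y -> F) (y : Y) : ext f (set_val y) = f y.
Proof. by rewrite /ext set_valE valK. Qed.

Lemma ext_out (F : lmodType R) (f : Y -> F) x : ~ Y x ->
  ext f x = \sum_(n < N x) p n x *: f (a n x).
Proof. by move=> nYx; rewrite /ext insubN//; apply/negP; rewrite inE. Qed.

Lemma ext_linear (F : lmodType R) k (f g h : Y -> F) x :
  (forall y, h y = k *: f y + g y) -> ext h x = k *: ext f x + ext g x.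
Proof.
move=> hE; rewrite /ext; case: insub => [y|]; first exact: hE.
rewrite scaler_sumr -big_split /=; apply: eq_bigr => n _.
by rewrite hE scalerDr !scalerA mulrC.
Qed.

(** This is the one estimate behind both continuity of each extension at points of [Y] and
    continuity of the operator. *)
Lemma ext_convex (F : lmodType R) (f : Y -> F) (V : set F) x :
  convex_set V -> (forall c, supp x c -> V (f c)) -> V (ext f x).
Proof.
move=> convV fV; have [Yx|nYx] := pselect (Y x).
  pose y : Y := SigSub (mem_set Yx).
  have <- : set_val y = x by [].
  by rewrite ext_val; apply: fV; left.
have [p1 _] := nbhs_singleton (p_part nYx).
rewrite ext_out//.
apply: (@convex_set_sum _ _ V _ (p ^~ x) (fun n => f (a n x))) => // n pn0.
by apply: fV; right; split => //; exists n.
Qed.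

Lemma supp_near x c : supp x c -> forall z : Y,
  mdist x (set_val c) <= 2 * mdist x (set_val z).
Proof.
move=> [<-|[_ [n pn0 <-]]] z; last exact: a_near.
by rewrite mdistxx mulr_ge0// mdist_ge0.
Qed.

(** A point of [supp x] is at most twice as far from [x] as [y] is, hence less than 1 + 2 = 3 times
    e / 3 from [y]. *)
Lemma supp_ball (y c : Y) x e : supp x c -> mdist (set_val y) x < e / 3 ->
  ball y e c.
Proof.
move=> /supp_near/(_ y) xc yx; rewrite ballEmdist /= mdist_setE.
have := metric_triangle (set_val y) x (set_val c).
rewrite (metric_sym x (set_val y)) in xc *; lra.
Qed.

Lemma ext_cts_in (F : tvsType R) (f : continuousType Y F) (y : Y) :
  {for set_val y, continuous (ext f)}.
Proof.
move=> V; rewrite ext_val => /tvs_convex_nbhs[W [convW Wfy WV]].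
have := @cts_fun _ _ f y _ Wfy; rewrite -nbhs_ballE => -[e /= e0 eW].
suff : \forall x \near set_val y, W (ext f x).
  by apply: filterS => x; exact: WV.
near=> x; apply: ext_convex => // c xc; apply: (eW c); apply: (supp_ball xc).
near: x; have := nbhsx_ballx (set_val y) (e / 3); rewrite ballEmdist.
by apply; rewrite divr_gt0.
Unshelve. all: by end_near. Qed.

Lemma near_out (x : X) : ~ Y x -> exists c : nat -> Y, \forall y \near x,
  [/\ ~ Y y, forall n, (N x <= n)%N -> p n y = 0 &
    forall n, p n y != 0 -> a n y = c n].
Proof.
move=> nYx; have /choice[c cP] := a_loc ^~ x; exists c.
have cN : \forall y \near x, forall n : 'I_(N x), p n y != 0 -> a n y = c n.
  by apply: filter_forall => n; exact: cP.
have nY : \forall y \near x, ~ Y y.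
  by have := closed_openC closedY; rewrite openE; exact.
near=> y.
have [_ p0] : \sum_(n < N x) p n y = 1 /\ forall n, (N x <= n)%N -> p n y = 0.
  by near: y; exact: p_part.
split => //; first by near: y.
move=> n; have [nN|nN] := ltnP n (N x); last by rewrite p0// eqxx.
have cNy : forall n : 'I_(N x), p n y != 0 -> a n y = c n by near: y.
exact: (cNy (Ordinal nN)).
Unshelve. all: by end_near. Qed.

(** The bound [N y] in [ext] varies with [y]; this allows the fixed bound [N x] near [x]. *)
Lemma sum_cutoff (F : lmodType R) (z : nat -> F) x M M' :
    (forall n, (M <= n)%N -> p n x = 0) ->
    (forall n, (M' <= n)%N -> p n x = 0) ->
  \sum_(n < M) p n x *: z n = \sum_(n < M') p n x *: z n.
Proof.
wlog MM' : M M' / (M <= M')%N.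
  move=> H; have [MM'|/ltnW MM'] := leqP M M' => pM pM'; first exact: H.
  by apply/esym/H.
move=> pM _; rewrite -(subnKC MM') big_split_ord /= [X in _ + X]big1 ?addr0//.
by move=> i _; rewrite pM ?leq_addr// scale0r.
Qed.

Lemma ext_cts_out (F : tvsType R) (f : Y -> F) x : ~ Y x ->
  {for x, continuous (ext f)}.
Proof.
move=> nYx; have [c cP] := near_out nYx.
have extE : \forall y \near x,
    ext f y = \sum_(n < N x) p n y *: f (c n).
  near=> y; have [nYy pN ac] : [/\ ~ Y y, forall n, (N x <= n)%N -> p n y = 0 &
    forall n, p n y != 0 -> a n y = c n] by near: y.
  rewrite ext_out// (@sum_cutoff _ (fun n => f (a n y)) _ _ (N x))//.
    apply: eq_bigr => n _; have [->|/ac->//] := eqVneq (p n y) 0.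
    by rewrite !scale0r.
  by have [] := nbhs_singleton (p_part nYy).
rewrite /prop_for /continuous_at (nbhs_singleton extE).
have sumE : {near x, (fun y => \sum_(n < N x) p n y *: f (c n)) =1 ext f}.
  by apply: filterS extE => y /= ->.
apply: (cvg_trans (near_eq_cvg sumE)).
apply: (@cvg_big _ _ _ _ _ (@add_continuous F)) => n _.
apply: (@continuous_comp _ _ _ (fun y => (p n y : R^o, f (c n)))
  (fun w : R^o * F => w.1 *: w.2) x); last exact: scale_continuous.
apply: (@cvg_pair _ _ _ _ (nbhs (p n x : R^o))); first exact: p_cts.
exact: cvg_cst.
Unshelve. all: by end_near. Qed.

Lemma ext_cts (F : tvsType R) (f : continuousType Y F) : continuous (ext f).
Proof.
move=> x; have [Yx|] := pselect (Y x); last exact: ext_cts_out.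
exact: (@ext_cts_in _ f (SigSub (mem_set Yx))).
Qed.

(** The set-valued map [supp] behaves as an upper semicontinuous one, so near-coverings of the union
    pull back to near-coverings of [K]. *)
Lemma compact_supp (K : set X) : compact K ->
  compact [set c | exists2 x, K x & supp x c].
Proof.
move=> /compact_near_coveringP/near_covering_withinP covK; set L := [set _ | _].
apply/compact_near_coveringP => I Fi P FF covL.
suff : \near Fi, K `<=` (fun x => forall c, supp x c -> P Fi c).
  by apply: filterS => i iK c [x Kx xc]; exact: iK xc.
apply: (covK I Fi (fun i x => forall c, supp x c -> P i c)) => x Kx.
have [Yx|nYx] := pselect (Y x).
  pose y : Y := SigSub (mem_set Yx).
  have [|[A B] /= [Ay FB] ABP] := covL y; first by exists x => //; left.
  move: Ay; rewrite -nbhs_ballE => -[e /= e0 eA].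
  exists (ball x (e / 3), B).
    by split => //; apply: nbhsx_ballx; rewrite divr_gt0.
  move=> [x' i] /= [xx' Bi] _ c x'c; apply: (ABP (c, i)); split => //=.
  by apply: eA; apply: (supp_ball x'c); rewrite ballEmdist in xx'.
have [c cP] := near_out nYx.
(* A candidate [c n] may have no weight at any point of [K] and so lie outside [L], where the
   covering says nothing; hence the guard. *)
have BF : \forall i \near Fi, forall n : 'I_(N x), L (c n) -> P i (c n).
  apply: filter_forall => n; have [Lcn|nLcn] := pselect (L (c n)).
    have [[A B] /= [Ac FB] ABP] := covL _ Lcn.
    apply: filterS FB => i Bi _; apply: (ABP (c n, i)); split => //=.
    exact: nbhs_singleton.
  exact: nearW.
exists ([set y | [/\ ~ Y y, forall n, (N x <= n)%N -> p n y = 0 &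
    forall n, p n y != 0 -> a n y = c n]],
  [set i | forall n : 'I_(N x), L (c n) -> P i (c n)]); first by split.
move=> [x' i] /= [[nYx' pN ac] Pi] Kx' d x'd.
have [x'E|[_ [n pn0 adE]]] := x'd.
  by rewrite -x'E in nYx'; have := set_valP d.
have dE : d = c n by rewrite -adE ac.
have nN : (n < N x)%N.
  by rewrite ltnNge; apply/negP => /pN pn; rewrite pn eqxx in pn0.
by rewrite dE; apply: (Pi (Ordinal nN)); rewrite -dE; exists x'.
Qed.

Lemma ext_operator (F : tvsType R) :
  exists E : {linear continuousType Y F -> continuousType X F},
    continuous (E : continuousType Y F -> continuousType X F) /\
    cancel E (cts_restr Y).
Proof.
pose E0 (f : continuousType Y F) : continuousType X F := mkcts (@ext_cts F f).
have E0lin : linear E0.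
  by move=> k f g; apply/continuousEP => x; exact: ext_linear.
pose linE := GRing.isLinear.Build _ _ _ _ E0 E0lin.
pose E : {linear continuousType Y F -> continuousType X F} := HB.pack E0 linE.
exists E; split; last first.
  by move=> f; apply/continuousEP => y; exact: ext_val.
apply: continuous_comp_initial => f.
have FF := @nbhs_filter (continuousType Y F) f.
apply: (iffRL (@compact_open_cvgP X F _ _ (fmap_filter _ FF))).
move=> K O cptK oO EfO.
have cptEfK : compact (ext f @` K).
  apply: continuous_compact => //; apply: continuous_subspaceT; exact: ext_cts.
have /compact_near_coveringP covEfK := cptEfK.
(* Compactness of the image of [K] gives one convex neighbourhood [W] of 0 by which the whole image
   can be translated inside [O]. By linearity it then suffices that [g - f] maps the supports over
   [K] into [W]. *)
have /tvs_convex_nbhs[W [convW W0 WO]] :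
    \forall v \near (0 : F), ext f @` K `<=` (fun w => O (w + v)).
  apply: covEfK => w Efw.
  have := @add_continuous F (w, 0) O; rewrite /= addr0; apply.
  by apply: open_nbhs_nbhs; split => //; exact: EfO.
have := compact_open_near_sub f (compact_supp cptK) W0.
apply: filterS => g gW _ [x Kx <-].
have EgE : ext g x = ext f x + ext (g - f) x.
  rewrite -[ext f x]scale1r; apply: ext_linear => y.
  by rewrite scale1r ctsDE addrC subrK.
suff : O (ext f x + ext (g - f) x) by rewrite -EgE.
apply: (WO (ext (g - f) x)); last by exists x.
by apply: ext_convex => // c xc; apply: gW; exists x.
Qed.

End extension.

Theorem proposition1p14 (R : realType) (X : metricType R) (Y : set X)
    (closedY : closed Y)
    (hY : locally_compact [set: Y] \/ complete_metric (Y : metricType R))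
    (F : tvsType R) (hausdorffF : hausdorff_space F) :
  exists E : {linear continuousType Y F -> continuousType X F},
    continuous (E : continuousType Y F -> continuousType X F) /\
    cancel E (cts_restr Y).
Proof.
have [Y0|/set0P Yne] := eqVneq Y set0; last first.
  have [p [a [N [? ? ? ? ?]]]] := dugundji_partition closedY Yne.
  exact: (@ext_operator _ _ _ closedY p a N).
(* For empty [Y] there is only one map from [Y] to [F], so the zero operator is a right inverse. *)
exists (\0%R : {linear continuousType Y F -> continuousType X F}); split.
  exact: (@cst_continuous (continuousType Y F) (continuousType X F) 0).
move=> f; apply/continuousEP => y; exfalso.
by have := set_valP y; rewrite [X in X (set_val y)]Y0.
Qed.
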